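(* Let $\mathcal{B}$ be a finite group, let $\mathbb{V}$ be a finite set, and let $\mathfrak{g}:\mathcal{B}^{\mathbb{V}}\to\mathcal{B}$ be a group homomorphism. Then there are group endomorphisms $\mathfrak{g}_{\mathsf{v}}$ of $\mathcal{B}$, for all $\mathsf{v}\in\mathbb{V}$, such that for any $\mathbf{b}=(b_{\mathsf{v}})_{\mathsf{v}\in\mathbb{V}}\in\mathcal{B}^{\mathbb{V}}$, $$\mathfrak{g}(\mathbf{b})=\prod_{\mathsf{v}\in\mathbb{V}}\mathfrak{g}_{\mathsf{v}}(b_{\mathsf{v}}),$$ where this product is commutative (i.e. its factors commute with one another).
   Context: $\mathcal{B}^{\mathbb{V}}$ is the product group with componentwise multiplication. *)

(* Defs.v *)
From mathcomp Require Import all_boot all_fingroup.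

(* Main.v *)
Require Import Defs.
From mathcomp Require Import all_boot all_fingroup.

(** The coordinate inclusions [dfung1 v] of [B] into the power [B^V] are
    homomorphisms with pairwise commuting images, and every [b] is the product
    of its coordinate parts [dfung1 v (b v)].  Any homomorphism [g] out of
    [B^V] preserves this factorisation and these commutations, so the
    endomorphisms [g \o dfung1 v] are the ones sought. *)

Set Implicit Arguments.
Unset Strict Implicit.
Unset Printing Implicit Defensive.

Local Open Scope group_scope.

Section CoordinateInclusions.

Variables (I : finType) (gT : I -> finGroupType).
Implicit Types b : {dffun forall i, gT i}.

(** At each coordinate at least one of the two factors is trivial. *)
Lemma commute_dfung1 (i j : I) (x : gT i) (y : gT j) :
  i != j -> commute (dfung1 x) (dfung1 y).
Proof.
move=> neq_ij; apply/ffunP => k; rewrite !ffunE.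
have [<-|neq_ik] := eqVneq i k.
  by rewrite [dfwith _ y i]dfwith_out 1?eq_sym // mulg1 mul1g.
by rewrite [dfwith _ x k]dfwith_out // mulg1 mul1g.
Qed.

Lemma prod_dfung1 b : b = \prod_i dfung1 (b i).
Proof.
apply/ffunP => k; rewrite prodg_ffun (big_only1 k) ?dfung1_id //.
by move=> i neq_ik _; rewrite dfung1_dflt.
Qed.

End CoordinateInclusions.

Theorem lemma2 (B : finGroupType) (V : finType)
    (g : {morphism [set: {dffun forall _ : V, B}] >-> B}) :
  exists gv : V -> {morphism [set: B] >-> B},
    forall b : {dffun forall _ : V, B},
      g b = \prod_(v : V) gv v (b v)
      /\ (forall v w : V, v != w -> commute (gv v (b v)) (gv w (b w))).
Proof.
pose gv0 v x := g (@dfung1 V (fun=> B) v x).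
have gvM v : {in [set: B] &, {morph gv0 v : x y / x * y}}.
  by move=> x y _ _; rewrite /gv0 dfung1_morphM morphM ?inE.
exists (fun v => Morphism (gvM v)) => b; split=> [|v w neq_vw] /=.
  by rewrite [in LHS](prod_dfung1 b) morph_prod // => v _; rewrite inE.
by rewrite /commute -!morphM ?inE // commute_dfung1.
Qed.
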